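(* Let $a,b$ be integers with $a>b+1$ and $b>4$. Then the mountain-valley assignment $M^aV^b$ on the $1\times(a+b+1)$ strip of stamps has exactly $ab+b^2-b+1$ valid layer orderings, i.e. $c(M^aV^b)=ab+b^2-b+1$.
   Context: A $1\times n$ strip of stamps has faces labeled $0,1,\dots,n-1$ from left to right and $n-1$ creases, the crease $(i,i+1)$ lying between faces $i$ and $i+1$. A mountain-valley (MV) assignment is a map $\mu$ from the creases to $\{M,V\}$, written as the word $\mu((0,1))\mu((1,2))\cdots\mu((n-2,n-1))$; $S^k$ denotes the word $S$ repeated $k$ times, so $M^aV^b$ assigns $M$ to the first $a$ creases and $V$ to the last $b$. A permutation $\sigma$ of $\{0,\dots,n-1\}$ ($\sigma(i)$ = position of face $i$ in the folded stack, left to right) is a valid layer ordering for $\mu$ if: (1) for each crease $(i,i+1)$, if $\mu((i,i+1))=M$ and $i$ is even, or $\mu((i,i+1))=V$ and $i$ is odd, then $\sigma(i)>\sigma(i+1)$; otherwise $\sigma(i)<\sigma(i+1)$; (2) for any two creases $(i,i+1),(j,j+1)$ with $i\equiv j\pmod 2$, it is not the case that $\sigma(i)<\sigma(j)<\sigma(i+1)<\sigma(j+1)$, nor that this chain holds for any cyclic rotation of the sequence $(\sigma(i),\sigma(j),\sigma(i+1),\sigma(j+1))$. $c(\mu)$ denotes the number of valid layer orderings for $\mu$. *)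

(* Defs.v *)
From mathcomp Require Import all_boot all_fingroup.

Set Implicit Arguments.
Unset Strict Implicit.
Unset Printing Implicit Defensive.

Inductive mv : Type := Mountain | Valley.

(* The strip with n creases has n.+1 faces.  A crease i : 'I_n stands for the
   crease (i, i+1). *)
Definition lface n (i : 'I_n) : 'I_n.+1 := widen_ord (leqnSn n) i.
Definition rface n (i : 'I_n) : 'I_n.+1 := lift ord0 i.

(* An MV assignment is given by its word mu : n.-tuple mv, whose i-th letter is
   the label of the crease (i, i+1). *)

Definition respects_mv n (mu : n.-tuple mv) (s : {perm 'I_n.+1}) : bool :=
  [forall i : 'I_n,
     if match tnth mu i with Mountain => ~~ odd i | Valley => odd i end
     then s (lface i) > s (rface i)
     else s (lface i) < s (rface i)].

Definition no_crossing n (s : {perm 'I_n.+1}) : bool :=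
  [forall i : 'I_n, forall j : 'I_n, (odd i == odd j) ==>
     [forall k : 'I_4,
        ~~ sorted ltn (rot k [:: s (lface i) : nat; s (lface j) : nat;
                                 s (rface i) : nat; s (rface j) : nat])]].

Definition valid_layer_ordering n (mu : n.-tuple mv) (s : {perm 'I_n.+1}) : bool :=
  respects_mv mu s && no_crossing s.

Definition num_layer_orderings n (mu : n.-tuple mv) : nat :=
  #|[set s : {perm 'I_n.+1} | valid_layer_ordering mu s]|.

Definition mountains_valleys (a b : nat) : (a + b).-tuple mv :=
  [tuple of nseq a Mountain ++ nseq b Valley].

(* Main.v *)
Require Import Defs.
From mathcomp Require Import all_boot all_fingroup zify.

(* The strip is built face by face.  A new face can always be placed next to the
   previous one, and this tight placement is unique; so the orderings of one more face
   split into the tight ones, in bijection with the orderings of the shorter strip, and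
   the loose ones.  After two equal letters a tight end is trapped between its two last
   faces: the next face, if it carries the same letter again, is tight as well.  Hence
   the loose orderings of M^a V^j (j > 2) all come from loose ones of M^a V^(j - 1).

   The part M^a is a spiral whose first i faces wind outwards and whose other faces wind
   inwards, for some 0 < i <= a.  The end of a loose valley part walks out of that pocket
   and then around the stack; it may leave this route at two places to wind down along
   the outward spiral, and never gets to the center since j + 2 <= a.  This gives a + 1
   orderings of M^a V and a + j + (j - 2) loose orderings of M^a V^j for j > 1, which sum
   to the formula. *)

Set Implicit Arguments.
Unset Strict Implicit.
Unset Printing Implicit Defensive.

(** * Orderings as numerical keys on the faces *)

(* The crease [n] of M^a V^b goes up in the stack. *)
Definition up a n := if n < a then odd n else ~~ odd n.

Definition lt_dir (d : bool) x y := if d then x < y else y < x.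

Definition between x y z := (x < z < y) || (y < z < x).

(** Keys are arbitrary naturals, since only their order matters. Noncrossing asks that both ends of
    [e'] or neither lie between those of [e]; for distinct ends [rotations_between] translates this
    into the rotated chains. *)
Definition valid a n (k : nat -> nat) :=
  (forall m, m < n -> lt_dir (up a m) (k m) (k m.+1)) /\
  (forall e e', e < n -> e' < n -> odd e = odd e' ->
     between (k e) (k e.+1) (k e') = between (k e) (k e.+1) (k e'.+1)).

Definition inj_upto n (k : nat -> nat) :=
  forall f g, f <= n -> g <= n -> k f = k g -> f = g.

Definition same_order n (k K : nat -> nat) :=
  forall f g, f <= n -> g <= n -> (k f < k g) = (K f < K g).

Definition loose n (k : nat -> nat) :=
  exists2 f, f <= n & between (k n) (k n.+1) (k f).

Lemma valid_prefix a m n k : m <= n -> valid a n k -> valid a m k.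
Proof.
move=> le_mn [dirk ncrk]; split=> [j lt_jm|e e' lt_em lt_e'm].
  by apply: dirk; lia.
by apply: ncrk; lia.
Qed.

Lemma inj_prefix m n k : m <= n -> inj_upto n k -> inj_upto m k.
Proof. by move=> le_mn injk f g lef leg; apply: injk; lia. Qed.

Lemma same_order_prefix m n k K :
  m <= n -> same_order n k K -> same_order m k K.
Proof. by move=> le_mn eqk f g lef leg; apply: eqk; lia. Qed.

Lemma same_order_sym n k K : same_order n k K -> same_order n K k.
Proof. by move=> eqk f g lef leg; rewrite eqk. Qed.

Lemma same_order_trans n k1 k2 k3 :
  same_order n k1 k2 -> same_order n k2 k3 -> same_order n k1 k3.
Proof. by move=> eq12 eq23 f g lef leg; rewrite eq12 ?eq23. Qed.

Lemma same_order_dir n k K d f g :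
  same_order n k K -> f <= n -> g <= n ->
  lt_dir d (k f) (k g) = lt_dir d (K f) (K g).
Proof. by move=> eqk lef leg; rewrite /lt_dir !eqk. Qed.

Lemma same_order_between n k K f g h :
  same_order n k K -> f <= n -> g <= n -> h <= n ->
  between (k f) (k g) (k h) = between (K f) (K g) (K h).
Proof. by move=> eqk lef leg leh; rewrite /between !eqk. Qed.

Lemma same_order_valid a n k K : same_order n k K -> valid a n K -> valid a n k.
Proof.
move=> eqk [dirK ncrK]; split=> [m lt_mn|e e' lt_en lt_e'n par].
  by have := dirK m lt_mn; rewrite /lt_dir !eqk //; lia.
have btwE f : f <= n ->
    between (k e) (k e.+1) (k f) = between (K e) (K e.+1) (K f).
  by move=> lef; apply: same_order_between eqk _ _ _ => //; lia.
by rewrite !btwE; [exact: ncrK | lia | lia].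
Qed.

Lemma same_order_loose n k K : same_order n.+1 k K -> loose n K -> loose n k.
Proof.
move=> eqk [f lef btw]; exists f => //.
by rewrite (same_order_between eqk) //; lia.
Qed.

Lemma same_order_extend n k K :
  inj_upto n.+1 k -> inj_upto n.+1 K -> same_order n k K ->
  (forall f, f <= n -> (k f < k n.+1) = (K f < K n.+1)) ->
  same_order n.+1 k K.
Proof.
move=> injk injK eqk eqx f g lef leg.
have [ltf|eqf] : f <= n \/ f = n.+1 by lia.
  have [ltg|->] : g <= n \/ g = n.+1 by lia.
    by apply: eqk.
  by apply: eqx.
have [ltg|->] : g <= n \/ g = n.+1 by lia.
  rewrite eqf; have := eqx g ltg.
  have : k g <> k n.+1 by move/(injk g n.+1); lia.
  have : K g <> K n.+1 by move/(injK g n.+1); lia.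
  by lia.
by rewrite eqf !ltnn.
Qed.

(** * Adding one face: which positions are valid *)

Definition closed_arcs n (P : nat -> bool) :=
  forall e, e < n -> odd e = odd n -> P e = P e.+1.

(** [P] is the set of faces jumped over by the new crease [n]. The crease crosses no older one
    exactly when this set contains both ends or neither end of each arc on its side. *)
Lemma valid_extend a n k P :
  inj_upto n.+1 k -> valid a n k -> lt_dir (up a n) (k n) (k n.+1) ->
  closed_arcs n P ->
  (forall f, f <= n -> between (k n) (k n.+1) (k f) = P f) ->
  valid a n.+1 k.
Proof.
move=> injk [dirk ncrk] dirn clP btwP; split=> [m|e e'].
  rewrite ltnS leq_eqVlt => /orP[/eqP->//|]; exact: dirk.
have new e1 : e1 < n -> odd e1 = odd n ->
    between (k n) (k n.+1) (k e1) = between (k n) (k n.+1) (k e1.+1).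
  by move=> lt1 par1; rewrite !btwP; [exact: clP | lia | lia].
rewrite !ltnS leq_eqVlt => /orP[/eqP->|lten];
  rewrite leq_eqVlt => /orP[/eqP->|lte'n] par.
- by rewrite /between; lia.
- by rewrite new.
(* Crossing is symmetric in two creases with four distinct ends, so the old crease [e] against the
   new one follows from the converse; parity rules out [e.+1 = n]. *)
- have := new e lten par.
  have neq f : f <= n -> k f <> k n.+1 by move=> lef /(injk f n.+1); lia.
  have neq' f : f < n -> k f <> k n by move=> lef /(injk f n); lia.
  have e1n : e.+1 < n.
    have : e.+1 <> n by move=> eqn; move: par; rewrite -eqn /=; case: (odd e).
    lia.
  have := neq e; have := neq e.+1; have := neq' e; have := neq' e.+1.
  have : k e <> k e.+1 by move/(injk e e.+1); lia.
  have : k n <> k n.+1 by move/(injk n n.+1); lia.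
  by rewrite /between; lia.
- exact: ncrk.
Qed.

(* The face [y] is an end of an arc [(y, z)] on the side of the next crease;
   face 0 carries no arc on the odd side. *)
Definition arc n y z :=
  [\/ [/\ z = y.+1, y < n & odd y = odd n],
      [/\ y = z.+1, z < n & odd z = odd n] |
      [/\ y = 0, z = 0 & odd n]].

(** Closed, unlike [between]: the ends of an arc are themselves jumped over, and the arc at face 0
    contributes this single face. *)
Definition inside (k : nat -> nat) y z f :=
  (k y <= k f <= k z) || (k z <= k f <= k y).

Lemma arc_leq n y z : arc n y z -> (y <= n) * (z <= n).
Proof. by case=> [[-> ? _]|[-> ? _]|[-> ->]]; split; lia. Qed.

Lemma between_inside x y u v :
  x <> u -> x <> v -> y <> u -> y <> v ->
  between x y u = between x y v ->
  (x <= u <= y) || (y <= u <= x) = ((x <= v <= y) || (y <= v <= x)).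
Proof. by rewrite /between; lia. Qed.

Lemma odd_neqS m n : odd m = odd n -> m.+1 <> n.
Proof. by move=> par eqn; move: par; rewrite -eqn /=; case: odd. Qed.

Lemma inside_crease n k y e :
  inj_upto n k -> y < n -> e < n -> odd y = odd e ->
  between (k y) (k y.+1) (k e) = between (k y) (k y.+1) (k e.+1) ->
  inside k y y.+1 e = inside k y y.+1 e.+1.
Proof.
move=> injk lty lte par btw; rewrite /inside.
have [->|ney] := eqVneq e y; first by lia.
have neq f g : f <= n -> g <= n -> f <> g -> k f <> k g.
  by move=> lef leg nefg /injk; auto.
have := odd_neqS par; have := odd_neqS (esym par) => ? ?.
by apply: between_inside btw; apply: neq; lia.
Qed.

Lemma inside_sym k y z f : inside k y z f = inside k z y f.
Proof. exact: orbC. Qed.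

(** Noncrossing arcs are nested or disjoint, so the span of one arc splits no other. Face 0 carries
    no crease on the odd side, so its degenerate arc splits none either. *)
Lemma inside_closed a n k y z :
  inj_upto n k -> valid a n k -> arc n y z -> closed_arcs n (inside k y z).
Proof.
move=> injk [_ ncrk] arcyz e lten par.
have [[? ltn pary]|[? ltn parz]|[? ? nodd]] := arcyz; subst.
- by apply: (inside_crease injk) => //; [lia|apply: ncrk => //; lia].
- rewrite !(inside_sym _ z.+1).
  by apply: (inside_crease injk) => //; [lia|apply: ncrk => //; lia].
- have e0 : e <> 0 by move=> ee; move: par nodd; rewrite ee /= => <-.
  have ne f : f <= n -> f <> 0 -> k f <> k 0 by move=> lef nef /injk; auto.
  have := ne e (ltnW lten) e0; have : k e.+1 <> k 0 by apply: ne.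
  by rewrite /inside; lia.
Qed.

(** An arc with both ends ahead of the tip is jumped over entirely or not at all, since the new
    crease starts outside it. *)
Lemma arc_below a n k K d y z :
  valid a n.+1 k -> inj_upto n.+1 k -> same_order n k K -> d = up a n ->
  arc n y z -> lt_dir d (K n) (K y) -> lt_dir d (K n) (K z) ->
  lt_dir d (k y) (k n.+1) = lt_dir d (k z) (k n.+1).
Proof.
move=> [dirk ncrk] injk eqk -> arcyz; have [ley lez] := arc_leq arcyz.
have dirn := dirk n (ltnSn n).
rewrite -!(same_order_dir _ eqk) //.
have neq f : f <= n -> k f <> k n.+1 by move=> lef /(injk f n.+1); lia.
have := neq y ley; have := neq z lez.
have [[? ltn pary]|[? ltn parz]|[? ? nodd]] := arcyz; subst => //.
- have := ncrk n y (ltnSn n) (ltnW ltn) (esym pary).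
  by move: dirn; rewrite /lt_dir /between; case: (up _ _); lia.
- have := ncrk n z (ltnSn n) (ltnW ltn) (esym parz).
  by move: dirn; rewrite /lt_dir /between; case: (up _ _); lia.
Qed.

(** The arc [(w, v)] encloses the tip on the side of the new crease, which therefore cannot get past
    [w]. *)
Lemma wall_above a n k K d w v :
  valid a n.+1 k -> inj_upto n.+1 k -> same_order n k K -> d = up a n ->
  arc n w v -> lt_dir d (K n) (K w) -> lt_dir d (K v) (K n) ->
  ~~ lt_dir d (k w) (k n.+1).
Proof.
move=> [dirk ncrk] injk eqk -> arcwv; have [lew lev] := arc_leq arcwv.
have dirn := dirk n (ltnSn n).
rewrite -!(same_order_dir _ eqk) //.
have [[? ltn pary]|[? ltn parz]|[? ? nodd]] := arcwv; subst => //.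
- have := ncrk n w (ltnSn n) (ltnW ltn) (esym pary).
  by move: dirn; rewrite /lt_dir /between; case: (up _ _); lia.
- have := ncrk n v (ltnSn n) (ltnW ltn) (esym parz).
  by move: dirn; rewrite /lt_dir /between; case: (up _ _); lia.
- by rewrite /lt_dir; case: (up _ _); lia.
Qed.

(* The place of the face [n.+1] just beyond [z] is bounded by an end [w] of an arc that
   encloses the tip [n], or is the outermost one. *)
Definition slot n (K : nat -> nat) d z :=
  [/\ z <= n, lt_dir d (K z) (K n.+1) &
      (forall f, f <= n -> ~~ lt_dir d (K z) (K f)) \/
      exists w v, [/\ arc n w v, lt_dir d (K n) (K w), lt_dir d (K v) (K n),
        lt_dir d (K n.+1) (K w) &
        forall f, f <= n -> lt_dir d (K z) (K f) -> ~~ lt_dir d (K f) (K w)]].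

(** Once the new face is known to be beyond [z], the wall or the end of the stack leaves it only one
    place. *)
Lemma slot_same_order a n k K d z :
  valid a n.+1 k -> inj_upto n.+1 k -> inj_upto n.+1 K -> same_order n k K ->
  d = up a n -> slot n K d z -> lt_dir d (k z) (k n.+1) ->
  same_order n.+1 k K.
Proof.
move=> vk injk injK eqk dE [lez Kzx walls] kzx.
apply: same_order_extend => // f lef.
have neqk : k f <> k n.+1 by move/(injk f n.+1); lia.
have neqK : K f <> K n.+1 by move/(injK f n.+1); lia.
have := eqk f z lef lez; have := eqk z f lez lef.
case: walls => [top|[w [v [arcw Knw Kvn Kxw btw]]]].
  by have := top f lef; move: Kzx kzx; rewrite /lt_dir; case: (d); lia.
have [lew lev] := arc_leq arcw.
have kwx := wall_above vk injk eqk dE arcw Knw Kvn.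
have := btw f lef; have := eqk f w lef lew; have := eqk w f lew lef.
by move: Kzx kzx kwx Knw Kvn Kxw; rewrite /lt_dir; case: (d); lia.
Qed.

Definition gap n (K : nat -> nat) u v :=
  forall f, f <= n -> ~~ between (K u) (K v) (K f).

Lemma known_slot_same_order n k K d z w :
  inj_upto n.+1 k -> inj_upto n.+1 K -> same_order n k K ->
  z <= n -> w <= n -> gap n K z w ->
  lt_dir d (K z) (K n.+1) -> lt_dir d (K n.+1) (K w) ->
  lt_dir d (k z) (k n.+1) -> ~~ lt_dir d (k w) (k n.+1) ->
  same_order n.+1 k K.
Proof.
move=> injk injK eqk lez lew gapzw Kzx Kxw kzx kwx.
apply: same_order_extend => // f lef.
have neqk : k f <> k n.+1 by move/(injk f n.+1); lia.
have neqK : K f <> K n.+1 by move/(injK f n.+1); lia.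
have := eqk f z lef lez; have := eqk z f lez lef.
have := gapzw f lef; have := eqk f w lef lew; have := eqk w f lew lef.
by move: Kzx Kxw kzx kwx; rewrite /lt_dir /between; case: (d); lia.
Qed.

Lemma slot_gap n K d z :
  inj_upto n.+1 K -> slot n K d z -> gap n K z n.+1.
Proof.
move=> injK [lez Kzx walls] f lef.
have neqK : K f <> K n.+1 by move/(injK f n.+1); lia.
case: walls => [top|[w [v [arcw Knw Kvn Kxw btw]]]].
  by have := top f lef; move: Kzx; rewrite /lt_dir /between; case: (d); lia.
have := btw f lef; move: Kzx Knw Kvn Kxw.
by rewrite /lt_dir /between; case: (d); lia.
Qed.

(** The face [y] is the first one ahead of the tip, so a crease that jumps over any face jumps over
    [y]. *)
Lemma loose_below a n k K y :
  valid a n.+1 k -> inj_upto n k -> same_order n k K -> y <= n ->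
  lt_dir (up a n) (K n) (K y) -> gap n K n y -> loose n k ->
  lt_dir (up a n) (k y) (k n.+1).
Proof.
move=> [dirk _] injk eqk ley; rewrite -(same_order_dir _ eqk) //.
move=> kny gapny [f lef btw].
have := gapny f lef; rewrite -(same_order_between eqk) //.
have neqk : k f = k y \/ k f <> k y by lia.
have := dirk n (ltnSn n); move: kny btw.
by rewrite /lt_dir /between; case: (up _ _); lia.
Qed.

Lemma tight_valid a n K :
  inj_upto n.+1 K -> valid a n K -> lt_dir (up a n) (K n) (K n.+1) ->
  gap n K n n.+1 -> valid a n.+1 K.
Proof.
move=> injK vK dirn gapn.
apply: (@valid_extend a n K pred0) => // f lef.
by apply/negbTE/gapn.
Qed.

(** The face [y] is the first one ahead of the tip and [z] the far end of its arc; [y == z] covers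
    the degenerate arc at face 0. *)
Definition over_arc a n (K : nat -> nat) y z :=
  [/\ arc n y z, lt_dir (up a n) (K n) (K y),
      (y == z) || lt_dir (up a n) (K y) (K z) & gap n K n y].

Definition passes a n (K : nat -> nat) z :=
  lt_dir (up a n) (K z) (K n.+1) /\ gap n K z n.+1.

Lemma slot_passes a n K z :
  inj_upto n.+1 K -> slot n K (up a n) z -> passes a n K z.
Proof. by move=> injK slotz; split; [case: slotz|exact: slot_gap slotz]. Qed.

(** The new crease covers exactly the span of the arc [(y, z)], which is closed by
    [inside_closed]. *)
Lemma over_arc_valid a n K y z :
  inj_upto n.+1 K -> valid a n K -> over_arc a n K y z -> passes a n K z ->
  valid a n.+1 K /\ loose n K.
Proof.
move=> injK vK [arcyz Kny Kyz gapny] [Kzx gapz].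
have [ley lez] := arc_leq arcyz.
have injKn : inj_upto n K by apply: inj_prefix injK.
have eqyz : (y == z) -> K y = K z by move=> /eqP->.
split; last first.
  by exists y => //; move: Kny Kyz eqyz Kzx; rewrite /lt_dir /between; case: (up _ _); lia.
apply: (@valid_extend a n K (inside K y z)) => //.
- by move: Kny Kyz eqyz Kzx; rewrite /lt_dir; case: (up _ _); lia.
- exact: inside_closed vK arcyz.
move=> f lef; have := gapny f lef; have := gapz f lef.
have neqx : K f <> K n.+1 by move/(injK f n.+1); lia.
have neqn : K f = K n \/ K f <> K n by lia.
move: Kny Kyz eqyz Kzx.
by rewrite /lt_dir /between /inside; case: (up _ _); lia.
Qed.

Definition over_two_arcs a n (K : nat -> nat) y z y' z' :=
  [/\ over_arc a n K y z, arc n y' z', lt_dir (up a n) (K z) (K y'),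
      (y' == z') || lt_dir (up a n) (K y') (K z') & gap n K z y'].

Lemma over_two_arcs_valid a n K y z y' z' :
  inj_upto n.+1 K -> valid a n K -> over_two_arcs a n K y z y' z' ->
  passes a n K z' -> valid a n.+1 K /\ loose n K.
Proof.
move=> injK vK [[arcyz Kny Kyz gapny] arcyz' Kzy Kyz' gapzy] [Kzx gapz].
have [ley lez] := arc_leq arcyz; have [ley' lez'] := arc_leq arcyz'.
have injKn : inj_upto n K by apply: inj_prefix injK.
have eqyz : (y == z) -> K y = K z by move=> /eqP->.
have eqyz' : (y' == z') -> K y' = K z' by move=> /eqP->.
split; last first.
  exists y => //; move: Kny Kyz eqyz Kzy Kyz' eqyz' Kzx.
  by rewrite /lt_dir /between; case: (up _ _); lia.
apply: (@valid_extend a n K (predU (inside K y z) (inside K y' z'))) => //.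
- move: Kny Kyz eqyz Kzy Kyz' eqyz' Kzx.
  by rewrite /lt_dir; case: (up _ _); lia.
- move=> e lte par /=.
  by congr (_ || _); apply: (inside_closed injKn vK).
move=> f lef /=; have := gapny f lef; have := gapz f lef; have := gapzy f lef.
have neqx : K f <> K n.+1 by move/(injK f n.+1); lia.
move: Kny Kyz eqyz Kzy Kyz' eqyz' Kzx.
by rewrite /lt_dir /between /inside; case: (up _ _); lia.
Qed.

(** Looseness forces the new face beyond [y], the arc carries it beyond [z], and the slot fixes its
    place. *)
Lemma over_arc_same_order a n k K y z :
  inj_upto n.+1 K -> over_arc a n K y z -> slot n K (up a n) z ->
  valid a n.+1 k -> inj_upto n.+1 k -> same_order n k K -> loose n k ->
  same_order n.+1 k K.
Proof.
move=> injK [arcyz Kny Kyz gapny] slotz vk injk eqk lk.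
have [ley lez] := arc_leq arcyz.
apply: (slot_same_order vk injk injK eqk (erefl _) slotz).
have injkn : inj_upto n k by apply: inj_prefix injk.
rewrite -(arc_below vk injk eqk (erefl _) arcyz) //.
  exact: (loose_below vk injkn eqk ley Kny gapny lk).
have eqyz : (y == z) -> K y = K z by move=> /eqP->.
by move: Kny Kyz eqyz; rewrite /lt_dir; case: (up _ _); lia.
Qed.

(* Two nested choices: [K] stops after the first arc, [K'] passes both. *)
Lemma over_two_arcs_same_order a n k K K' y z y' z' :
  inj_upto n.+1 K -> inj_upto n.+1 K' ->
  over_two_arcs a n K' y z y' z' -> slot n K' (up a n) z' ->
  passes a n K z -> lt_dir (up a n) (K n.+1) (K y') ->
  (forall f, f <= n -> K f = K' f) ->
  valid a n.+1 k -> inj_upto n.+1 k -> same_order n k K' -> loose n k ->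
  same_order n.+1 k K \/ same_order n.+1 k K'.
Proof.
move=> injK injK' [[arcyz Kny Kyz gapny] arcyz' Kzy Kyz' gapzy] slotz'.
move=> [Kzx gapz] Kxy eqK vk injk eqk lk.
have [ley lez] := arc_leq arcyz; have [ley' lez'] := arc_leq arcyz'.
have injkn : inj_upto n k by apply: inj_prefix injk.
have eqkK : same_order n k K by move=> f g lef leg; rewrite eqk // !eqK.
have eqyz : (y == z) -> K' y = K' z by move=> /eqP->.
have eqyz' : (y' == z') -> K' y' = K' z' by move=> /eqP->.
have [Knz [Kny' Knz']] : lt_dir (up a n) (K' n) (K' z) /\
    lt_dir (up a n) (K' n) (K' y') /\ lt_dir (up a n) (K' n) (K' z').
  move: Kny Kyz eqyz Kzy Kyz' eqyz'; rewrite /lt_dir; case: (up _ _); lia.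
have kzx : lt_dir (up a n) (k z) (k n.+1).
  rewrite -(arc_below vk injk eqk (erefl _) arcyz) //.
  exact: (loose_below vk injkn eqk ley Kny gapny lk).
have [kyx|kyx] := boolP (lt_dir (up a n) (k y') (k n.+1)).
  right; apply: (slot_same_order vk injk injK' eqk (erefl _) slotz').
  by rewrite -(arc_below vk injk eqk (erefl _) arcyz').
left; apply: (known_slot_same_order injk injK eqkK lez ley' _ Kzx Kxy kzx kyx).
by move=> f lef; rewrite !eqK //; apply: gapzy.
Qed.

Lemma tight_same_order a n k K :
  inj_upto n.+1 K -> slot n K (up a n) n ->
  valid a n.+1 k -> inj_upto n.+1 k -> same_order n k K ->
  same_order n.+1 k K.
Proof.
move=> injK slotn vk injk eqk.
apply: (slot_same_order vk injk injK eqk (erefl _) slotn).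
by case: vk => + _; apply.
Qed.

(* Two choices for the tip: [K] places the next face next to it, [K'] passes an arc. *)
Lemma tight_or_over_arc a n k K K' y z :
  inj_upto n.+1 K -> inj_upto n.+1 K' ->
  over_arc a n K' y z -> slot n K' (up a n) z ->
  lt_dir (up a n) (K n) (K n.+1) -> lt_dir (up a n) (K n.+1) (K y) ->
  same_order n k K -> same_order n k K' ->
  valid a n.+1 k -> inj_upto n.+1 k ->
  same_order n.+1 k K \/ same_order n.+1 k K'.
Proof.
move=> injK injK' [arcyz Kny Kyz gapny] slotz Knx Kxy eqkK eqk vk injk.
have [ley lez] := arc_leq arcyz.
have [kyx|kyx] := boolP (lt_dir (up a n) (k y) (k n.+1)).
  right; apply: (slot_same_order vk injk injK' eqk (erefl _) slotz).
  rewrite -(arc_below vk injk eqk (erefl _) arcyz) //.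
  have eqyz : (y == z) -> K' y = K' z by move=> /eqP->.
  by move: Kny Kyz eqyz; rewrite /lt_dir; case: (up _ _); lia.
left; apply: (known_slot_same_order injk injK eqkK (leqnn n) ley _ Knx Kxy _ kyx).
  move=> f lef; rewrite -(same_order_between eqkK) // (same_order_between eqk) //.
  exact: gapny.
by case: vk => + _; apply.
Qed.

Lemma loose_or_gap n k : loose n k \/ gap n k n n.+1.
Proof.
have [/hasP[f]|/hasPn nbtw] :=
    boolP (has (fun f => between (k n) (k n.+1) (k f)) (iota 0 n.+1)).
  by rewrite mem_iota => lef btw; left; exists f => //; lia.
by right=> f lef; apply: nbtw; rewrite mem_iota; lia.
Qed.

(* The crease before a tight crease encloses the tip, and prevents the next crease
   with the same letter from leaving. *)
Lemma loose_prefix a n k :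
  inj_upto n.+3 k -> valid a n.+3 k ->
  up a n.+1 = ~~ up a n -> up a n.+2 = up a n ->
  loose n.+2 k -> loose n.+1 k.
Proof.
move=> injk [dirk ncrk] up1 up2 [f lef btw].
have [//|gapn] := loose_or_gap n.+1 k.
have par : odd n.+2 = odd n by rewrite /= negbK.
have := ncrk n.+2 n (leqnn _) (ltnW (ltnW (leqnn _))) par.
have neq g h : g <= n.+3 -> h <= n.+3 -> g <> h -> k g <> k h.
  by move=> leg leh negh /injk; auto.
have : k n <> k n.+2 by apply: neq; lia.
have : k n.+1 <> k n.+3 by apply: neq; lia.
have := gapn n (leqnSn n).
have gapf : f < n.+2 -> ~~ between (k n.+1) (k n.+2) (k f) by move=> ?; apply: gapn.
have eqf : ~~ (f < n.+2) -> k f = k n.+2 by move=> nlt; congr k; lia.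
have := dirk n; have := dirk n.+1; have := dirk n.+2.
rewrite up2 up1 !(ltnS, leqnn, leqnSn, ltnW) //.
move: gapf eqf btw; rewrite /lt_dir /between.
have [_|_] := boolP (f < n.+2); case: (up _ _) => /=; lia.
Qed.

(** * The explicit orderings *)

(** The center [8 * a + 8] exceeds all distances of faces up to [2 * a - 2], so the subtraction
    never truncates there. *)
Definition at_side a (s : bool) m := if s then 8 * a + 8 + m else 8 * a + 8 - m.

(* The faces below [i] wind outwards around the position [8 * a + 8], face [f] at distance
   [4 * f]; the faces [i .. a] wind inwards on the side of [i], beyond this core.  The
   valley faces follow the route [c]: the main one retraces the pocket and then circles
   the whole stack ([c = 0]); the route [c = 1] leaves it at the mouth of the pocket, the
   route [c = 2] three faces later, and face [f] then lies just inside [2 * a - 1 - f],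
   respectively just outside [2 * a + 1 - f], both in the core. *)
Definition key (a c i f : nat) :=
  if f < i then at_side a (~~ odd f) (4 * f)
  else if f <= a then
    at_side a (~~ odd i)
      (if odd f == odd i then 4 * a + 4 + 2 * i - 2 * f else 2 * i + 2 * f)
  else if (c == 1) && (2 * a <= i + f) then at_side a (odd f) (4 * (2 * a - f) - 5)
  else if (c == 2) && (2 * a + 3 <= i + f) then at_side a (odd f) (4 * (2 * a - f) + 5)
  else if odd f != odd i then at_side a (~~ odd i) (2 * i + 2 * f + 4)
  else if i + f <= 2 * a then at_side a (~~ odd i) (4 * a + 2 * i - 2 * f)
  else at_side a (odd i) (6 * i + 2 * f - 4 * a).

(** The position at distance [p - q] from the center, written without subtraction to keep all goals
    linear. *)
Definition on_side a (s : bool) p q t :=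
  if s then t + q = 8 * a + 8 + p else t + p = 8 * a + 8 + q.

Lemma on_side_at a s p q : q <= p -> p <= 8 * a + 8 + q ->
  on_side a s p q (at_side a s (p - q)).
Proof. by rewrite /on_side /at_side; case: s; lia. Qed.

Lemma on_side_at0 a s p : p <= 8 * a + 8 -> on_side a s p 0 (at_side a s p).
Proof. by rewrite /on_side /at_side; case: s; lia. Qed.

Variant key_spec (a c i f : nat) (oi o : bool) (t : nat) : Prop :=
| KeyBall of f < i & on_side a (~~ o) (4 * f) 0 t
| KeyPocketSame of i <= f <= a & o = oi &
    on_side a (~~ oi) (4 * a + 4 + 2 * i) (2 * f) t
| KeyPocketDiff of i <= f <= a & o = ~~ oi &
    on_side a (~~ oi) (2 * i + 2 * f) 0 t
| KeyBall1 of a < f & c = 1 & 2 * a <= i + f &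
    on_side a o (8 * a) (4 * f + 5) t
| KeyBall2 of a < f & c = 2 & 2 * a + 3 <= i + f &
    on_side a o (8 * a + 5) (4 * f) t
| KeyMainDiff of a < f & o = ~~ oi & c = 1 -> i + f < 2 * a &
    c = 2 -> i + f < 2 * a + 3 & on_side a (~~ oi) (2 * i + 2 * f + 4) 0 t
| KeyMainSame of a < f & o = oi & c = 1 -> i + f < 2 * a &
    i + f <= 2 * a & on_side a (~~ oi) (4 * a + 2 * i) (2 * f) t
| KeyMainOut of a < f & o = oi & c != 1 & c = 2 -> i + f < 2 * a + 3 &
    2 * a < i + f & on_side a oi (6 * i + 2 * f) (4 * a) t.

Lemma keyP a c i f : 0 < i <= a -> f + 2 <= 2 * a ->
  key_spec a c i f (odd i) (odd f) (key a c i f).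
Proof.
move=> hi hf; rewrite /key.
case: ifP => [fi|/negbT fi].
  by apply: KeyBall => //; apply: on_side_at0; lia.
case: ifP => [fa|/negbT fa].
  case: ifP => [/eqP par|/negbT/negP par].
    by apply: KeyPocketSame => //; [lia|apply: on_side_at; lia].
  apply: KeyPocketDiff; [lia|by move: par; do 2!case: odd|].
  by apply: on_side_at0; lia.
rewrite -ltnNge in fa.
case: ifP => [/andP[/eqP c1 far]|/negbT c1].
  apply: KeyBall1 => //.
  have -> : 4 * (2 * a - f) - 5 = 8 * a - (4 * f + 5) by lia.
  by apply: on_side_at; lia.
case: ifP => [/andP[/eqP c2 far]|/negbT c2].
  apply: KeyBall2 => //.
  have -> : 4 * (2 * a - f) + 5 = 8 * a + 5 - 4 * f by lia.
  by apply: on_side_at; lia.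
case: ifP => [/negP par|/negbT par].
  by apply: KeyMainDiff => //; try lia; apply: on_side_at0; lia.
rewrite negbK in par; move/eqP in par.
case: ifP => [far|/negbT far].
  by apply: KeyMainSame => //; [lia|apply: on_side_at; lia].
by apply: KeyMainOut => //; try lia; apply: on_side_at; lia.
Qed.

Lemma half_ex n : exists h, n = 2 * h + odd n.
Proof. by exists n./2; rewrite mul2n addnC odd_double_half. Qed.

(** Writing [f] as [2 * h + o] with a boolean [o] turns the parity conditions into linear
    arithmetic. *)
Lemma key_half a c i f oi : odd i = oi -> 0 < i <= a -> f + 2 <= 2 * a ->
  exists h (o : bool), f = 2 * h + o /\ key_spec a c i f oi o (key a c i f).
Proof.
move=> <- hi hf; have [h Ef] := half_ex f.
by exists h, (odd f); split=> //; apply: keyP.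
Qed.

(** Distances are even except on the routes 1 and 2 after separation, where they are 3 and 1 modulo
    4. The other branches differ in side, residue modulo 4 or range. *)
Lemma key_inj a c i n : 0 < i <= a -> n + 2 <= 2 * a -> inj_upto n (key a c i).
Proof.
move=> hi hn f g lef leg E.
have [h0 Ei] := half_ex i; move: Ei; case Pi: (odd i) => Ei.
all: have [h [o [Ef kf]]] := key_half c Pi hi (leq_trans (leq_add lef (leqnn 2)) hn).
all: have [h' [o' [Eg kg]]] := key_half c Pi hi (leq_trans (leq_add leg (leqnn 2)) hn).
all: rewrite -E in kg; clear E Pi; move: (key a c i f) kf kg => t kf kg.
all: case: o kf Ef => kf Ef; case: o' kg Eg => kg Eg.
all: by case: kf => //; case: kg => //; rewrite /on_side /=; lia.
Qed.

(** * Moves of the valley faces, one crease at a time *)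

Ltac arcs := first [by constructor 1; split; lia | by constructor 2; split; lia
                   | by constructor 3; split; lia].

Lemma up_mountain a n : n < a -> up a n = odd n.
Proof. by rewrite /up => ->. Qed.

Lemma up_valley a n : a <= n -> up a n = ~~ odd n.
Proof. by rewrite /up ltnNge => ->. Qed.

Ltac key_setup hi upE a c i n keyf :=
  let h := fresh "h" in let E := fresh "E" in let P := fresh "P" in
  let h' := fresh "h" in let E' := fresh "E" in
  rewrite /over_two_arcs /over_arc /slot /passes upE; clear upE;
  have [h E] := half_ex i; move: E; case P: (odd i) => E;
  have keyf := fun f => @key_half a c i f _ P hi; clear P;
  have [h' E'] := half_ex n; move: E'; case: (odd n) => E'.

Ltac key_look keyf F :=
  let h := fresh "h" in let o := fresh "o" in
  let E := fresh "E" in let S := fresh "S" in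
  have [h [o [E S]]] := keyf F ltac:(lia);
  case: o E S => /= E S; case: S; rewrite /on_side /=; intros;
  try discriminate; try (exfalso; lia);
  repeat match goal with H : _ = _ -> _ |- _ => clear H end.

Ltac key_close keyf :=
  rewrite /gap /lt_dir /between /=;
  repeat match goal with
    | |- _ /\ _ => split
    | |- and3 _ _ _ => split
    | |- and4 _ _ _ _ => split
    | |- and5 _ _ _ _ _ => split
    end; try assumption; try lia;
  let f := fresh "f" in let lef := fresh "lef" in
  move=> f lef; key_look keyf f; lia.

Lemma key_pocket_step a c i n w : 0 < i <= a -> n + 3 <= 2 * a -> a < n -> i <= w ->
  n + w + 2 = 2 * a ->
  over_arc a n (key a c i) w.+3 w.+2 /\ slot n (key a c i) (up a n) w.+2.
Proof.
move=> hi hn han hin hz.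
have upE : up a n = ~~ odd n by apply: up_valley; lia.
have arcw : arc n w w.+1 by arcs.
have arcw' : arc n w.+3 w.+2 by arcs.
key_setup hi upE a c i n keyf;
  key_look keyf n; key_look keyf w; key_look keyf w.+1; key_look keyf w.+2;
  key_look keyf w.+3; key_look keyf n.+1.
all: split; [|split; [lia| |right; exists w, w.+1]]; key_close keyf.
Qed.

(** The pocket is retraced up to its mouth. Past the arc [(i.+2, i.+1)] the face may go on into the
    core, where the arc [(i - 1, i)] stops it; this starts route 1. The other choice is
    [key_pocket_exit]. *)
Lemma key_ball_birth a i n : 1 < i <= a -> n + 3 <= 2 * a -> a < n ->
  i + n + 1 = 2 * a ->
  over_two_arcs a n (key a 1 i) i.+2 i.+1 (i - 2) (i - 3) /\
  slot n (key a 1 i) (up a n) (i - 3).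
Proof.
move=> hi' hn han hin; have hi : 0 < i <= a by lia.
have upE : up a n = ~~ odd n by apply: up_valley; lia.
have arc1 : arc n i.+2 i.+1 by arcs.
(* For [i = 2] both truncated differences are 0, and the arc is the degenerate one at face 0. *)
have arc2 : arc n (i - 2) (i - 3) by have [?|?] : i = 2 \/ 2 < i; [lia|arcs|arcs].
have arc3 : arc n (i - 1) i by arcs.
key_setup hi upE a 1 i n keyf;
  key_look keyf n; key_look keyf i.+2; key_look keyf i.+1; key_look keyf (i - 2);
  key_look keyf (i - 3); key_look keyf (i - 1); key_look keyf i; key_look keyf n.+1.
all: split; [|split; [lia| |right; exists (i - 1), i]]; key_close keyf.
Qed.

Lemma key_pocket_exit a c i n : c != 1 -> 1 < i <= a -> n + 3 <= 2 * a -> a < n ->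
  i + n + 1 = 2 * a ->
  [/\ over_arc a n (key a c i) i.+2 i.+1, passes a n (key a c i) i.+1 &
      lt_dir (up a n) (key a c i n.+1) (key a c i (i - 2))].
Proof.
move=> c1 hi' hn han hin; have hi : 0 < i <= a by lia.
have upE : up a n = ~~ odd n by apply: up_valley; lia.
have arc1 : arc n i.+2 i.+1 by arcs.
key_setup hi upE a c i n keyf;
  key_look keyf n; key_look keyf i.+2; key_look keyf i.+1; key_look keyf (i - 2);
  key_look keyf n.+1.
all: split; [|split|]; key_close keyf.
Qed.

Lemma key_mouth_step a c i n : c != 1 -> 0 < i <= a -> n + 3 <= 2 * a -> a < n ->
  i + n = 2 * a ->
  over_arc a n (key a c i) i.+1 i /\ slot n (key a c i) (up a n) i.
Proof.
move=> c1 hi hn han hin.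
have upE : up a n = ~~ odd n by apply: up_valley; lia.
have arc1 : arc n i.+1 i by arcs.
key_setup hi upE a c i n keyf;
  key_look keyf n; key_look keyf i.+1; key_look keyf i; key_look keyf n.+1.
all: split; [|split; [lia| |left]]; key_close keyf.
Qed.

Lemma key_outer_step a c i n : c != 1 -> 0 < i <= a -> n + 3 <= 2 * a -> a < n ->
  i + n = 2 * a + 1 ->
  over_arc a n (key a c i) i (i - 1) /\ slot n (key a c i) (up a n) (i - 1).
Proof.
move=> c1 hi hn han hin.
have upE : up a n = ~~ odd n by apply: up_valley; lia.
have arc1 : arc n i (i - 1) by arcs.
key_setup hi upE a c i n keyf;
  key_look keyf n; key_look keyf (i - 1); key_look keyf i; key_look keyf n.+1.
all: split; [|split; [lia| |left]]; key_close keyf.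
Qed.

(** On the first return from around the stack there is room between the arcs [(i - 1, i - 2)] and
    [(n - 2, n - 1)]. The main route passes both; route 2 stops in between, as in
    [key_second_entry]. *)
Lemma key_second_birth a i n : 0 < i <= a -> n + 3 <= 2 * a -> a < n ->
  i + n = 2 * a + 2 ->
  over_two_arcs a n (key a 0 i) (i - 1) (i - 2) (n - 2) (n - 1) /\
  slot n (key a 0 i) (up a n) (n - 1).
Proof.
move=> hi hn han hin.
have upE : up a n = ~~ odd n by apply: up_valley; lia.
have arc1 : arc n (i - 1) (i - 2) by arcs.
have arc2 : arc n (n - 2) (n - 1) by arcs.
key_setup hi upE a 0 i n keyf;
  key_look keyf n; key_look keyf (i - 1); key_look keyf (i - 2);
  key_look keyf (n - 1); key_look keyf (n - 2); key_look keyf n.+1.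
all: split; [|split; [lia| |left]]; key_close keyf.
Qed.

Lemma key_second_entry a i n : 0 < i <= a -> n + 3 <= 2 * a -> a < n ->
  i + n = 2 * a + 2 ->
  [/\ over_arc a n (key a 2 i) (i - 1) (i - 2), passes a n (key a 2 i) (i - 2) &
      lt_dir (up a n) (key a 2 i n.+1) (key a 2 i (n - 2))].
Proof.
move=> hi hn han hin.
have upE : up a n = ~~ odd n by apply: up_valley; lia.
have arc1 : arc n (i - 1) (i - 2) by arcs.
key_setup hi upE a 2 i n keyf;
  key_look keyf n; key_look keyf (i - 1); key_look keyf (i - 2);
  key_look keyf (n - 2); key_look keyf n.+1.
all: split; [|split|]; key_close keyf.
Qed.

(** The faces [n] and [n - 1] are the two outermost ones, so the arc [(n - 2, n - 1)] spans
    everything ahead of the tip. *)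
Lemma key_outward_step a i n : 0 < i <= a -> n + 3 <= 2 * a -> a < n ->
  2 * a + 3 <= i + n ->
  over_arc a n (key a 0 i) (n - 2) (n - 1) /\ slot n (key a 0 i) (up a n) (n - 1).
Proof.
move=> hi hn han hin.
have upE : up a n = ~~ odd n by apply: up_valley; lia.
have arc1 : arc n (n - 2) (n - 1) by arcs.
key_setup hi upE a 0 i n keyf;
  key_look keyf n; key_look keyf (n - 2); key_look keyf (n - 1); key_look keyf n.+1.
all: split; [|split; [lia| |left]]; key_close keyf.
Qed.

Lemma key_ball_step a i n p : 0 < i < a -> n + 3 <= 2 * a -> a < n ->
  2 * a <= i + n -> n + p + 1 = 2 * a ->
  over_arc a n (key a 1 i) (p - 2) (p - 3) /\
  slot n (key a 1 i) (up a n) (p - 3).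
Proof.
move=> hi' hn han hin hp; have hi : 0 < i <= a by lia.
have upE : up a n = ~~ odd n by apply: up_valley; lia.
have arc1 : arc n (p - 2) (p - 3) by have [?|?] : p = 2 \/ 2 < p; [lia|arcs|arcs].
have arc2 : arc n (p - 1) p by arcs.
key_setup hi upE a 1 i n keyf;
  key_look keyf n; key_look keyf p; key_look keyf (p - 1);
  key_look keyf (p - 2); key_look keyf (p - 3); key_look keyf n.+1.
all: split; [|split; [lia| |right; exists (p - 1), p]]; key_close keyf.
Qed.

Lemma key_second_step a i n p : 0 < i <= a -> n + 3 <= 2 * a -> a < n ->
  2 * a + 3 <= i + n -> n + p = 2 * a + 1 ->
  over_arc a n (key a 2 i) p (p - 1) /\ slot n (key a 2 i) (up a n) (p - 1).
Proof.
move=> hi hn han hin hp.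
have upE : up a n = ~~ odd n by apply: up_valley; lia.
have arc1 : arc n p (p - 1) by arcs.
have arc2 : arc n p.+1 p.+2 by arcs.
key_setup hi upE a 2 i n keyf;
  key_look keyf n; key_look keyf p; key_look keyf (p - 1);
  key_look keyf p.+1; key_look keyf p.+2; key_look keyf n.+1.
all: split; [|split; [lia| |right; exists p.+1, p.+2]]; key_close keyf.
Qed.

(** * The first valley crease *)

Lemma key_turn_pocket a c i : 0 < i -> i + 2 <= a -> slot a (key a c i) (up a a) a.
Proof.
move=> hi' hia; have hi : 0 < i <= a by lia.
have upE : up a a = ~~ odd a by apply: up_valley; lia.
have arc1 : arc a (a - 2) (a - 1) by arcs.
key_setup hi upE a c i a keyf;
  key_look keyf a; key_look keyf (a - 1); key_look keyf (a - 2); key_look keyf a.+1.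
all: split; [lia| |right; exists (a - 2), (a - 1)]; key_close keyf.
Qed.

(** With [i = a - 1] the pocket consists of the faces [a - 1] and [a] only, so the tip stands at its
    mouth already and route 1 can separate here. *)
Lemma key_turn_ball a i : 2 < a -> i + 1 = a ->
  over_arc a a (key a 1 i) (i - 2) (i - 3) /\
  slot a (key a 1 i) (up a a) (i - 3).
Proof.
move=> ha hia; have hi : 0 < i <= a by lia.
have upE : up a a = ~~ odd a by apply: up_valley; lia.
have arc1 : arc a (i - 2) (i - 3) by have [?|?] : i = 2 \/ 2 < i; [lia|arcs|arcs].
have arc2 : arc a (i - 1) i by arcs.
key_setup hi upE a 1 i a keyf;
  key_look keyf a; key_look keyf i; key_look keyf (i - 1);
  key_look keyf (i - 2); key_look keyf (i - 3); key_look keyf a.+1.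
all: split; [|split; [lia| |right; exists (i - 1), i]]; key_close keyf.
Qed.

Lemma key_turn_mouth a c i : c != 1 -> 2 < a -> i + 1 = a ->
  passes a a (key a c i) a /\
  lt_dir (up a a) (key a c i a.+1) (key a c i (i - 2)).
Proof.
move=> c1 ha hia; have hi : 0 < i <= a by lia.
have upE : up a a = ~~ odd a by apply: up_valley; lia.
key_setup hi upE a c i a keyf;
  key_look keyf a; key_look keyf (i - 2); key_look keyf a.+1.
all: split; [split|]; key_close keyf.
Qed.

Lemma key_turn_outer a c : c != 1 -> 2 < a -> slot a (key a c a) (up a a) a.
Proof.
move=> c1 ha; have hi : 0 < a <= a by lia.
have upE : up a a = ~~ odd a by apply: up_valley; lia.
key_setup hi upE a c a a keyf; key_look keyf a; key_look keyf a.+1.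
all: split; [lia| |left]; key_close keyf.
Qed.

(** * Moves of the mountain faces *)

Lemma key_inward_step a c i n : 0 < i < n -> n < a -> 2 < a ->
  slot n (key a c i) (up a n) n.
Proof.
move=> hin hna ha; have hi : 0 < i <= a by lia.
have upE : up a n = odd n by apply: up_mountain.
have arc1 : arc n (n - 1) (n - 2) by arcs.
key_setup hi upE a c i n keyf;
  key_look keyf n; key_look keyf (n - 1); key_look keyf (n - 2); key_look keyf n.+1.
all: split; [lia| |right; exists (n - 1), (n - 2)]; key_close keyf.
Qed.

Lemma key_core_step a c i n : 0 < n < i -> i <= a -> 2 < a ->
  over_arc a n (key a c i) (n - 2) (n - 1) /\ slot n (key a c i) (up a n) (n - 1).
Proof.
move=> hin hia ha; have hi : 0 < i <= a by lia.
have upE : up a n = odd n by apply: up_mountain; lia.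
(* For [n = 1] the truncated [n - 2] makes this the degenerate arc at face 0. *)
have arc1 : arc n (n - 2) (n - 1) by have [?|?] : n = 1 \/ 1 < n; [lia|arcs|arcs].
key_setup hi upE a c i n keyf;
  key_look keyf n; key_look keyf (n - 1); key_look keyf (n - 2); key_look keyf n.+1.
all: split; [|split; [lia| |left]]; key_close keyf.
Qed.

Lemma key_core_turn a c n : 0 < n < a -> 2 < a ->
  passes a n (key a c n) n /\
  lt_dir (up a n) (key a c n n.+1) (key a c n (n - 2)).
Proof.
move=> hn ha; have hi : 0 < n <= a by lia.
have upE : up a n = odd n by apply: up_mountain; lia.
key_setup hi upE a c n n keyf;
  key_look keyf n; key_look keyf (n - 2); key_look keyf n.+1.
all: split; [split|]; key_close keyf.
Qed.

(** The routes agree until they separate, so a branching compares keys that differ only in the new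
    face. *)
Lemma key_eq a c i f : f <= a \/ (c = 1 -> i + f < 2 * a) /\ (c = 2 -> i + f < 2 * a + 3) ->
  key a c i f = key a 0 i f.
Proof.
rewrite /key => near; case: ifP => // fi; case: ifP => // fa.
by have [-> ->] : (c == 1) && (2 * a <= i + f) = false /\
  (c == 2) && (2 * a + 3 <= i + f) = false by lia.
Qed.

Lemma key_first a c i : 0 < i <= a -> 2 < a -> key a c i 1 < key a c i 0.
Proof.
move=> hi ha; have [h Ei] := half_ex i; move: Ei; case P: (odd i) => Ei.
all: have keyf := fun f => @key_half a c i f _ P hi; clear P.
all: by key_look keyf 0; key_look keyf 1; lia.
Qed.

Lemma valid1 a k : 0 < a -> k 1 < k 0 -> valid a 1 k.
Proof.
move=> ha k10; split=> [[]//|[|//] [|//] _ _ _]; first by rewrite /lt_dir /up ha.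
by rewrite /between; lia.
Qed.

(** * The explicit orderings are valid, and there are no others *)

(** Every crease makes a tight move, passes one arc or passes two; after the first valley crease
    each move passes an arc, whence looseness. *)
Lemma key_extend a c i n :
  2 < a -> 0 < i <= a -> (c = 1 -> i < a) -> c <= 2 -> 0 < n ->
  n + 3 <= 2 * a -> valid a n (key a c i) ->
  valid a n.+1 (key a c i) /\ (a < n -> loose n (key a c i)).
Proof.
move=> ha hi ci c2 n0 hn vn.
have injn : inj_upto n.+1 (key a c i) by apply: key_inj; lia.
have tight : passes a n (key a c i) n -> n <= a ->
    valid a n.+1 (key a c i) /\ (a < n -> loose n (key a c i)).
  by case=> dirn gapn na; split; [exact: tight_valid gapn|lia].
have jump y z : over_arc a n (key a c i) y z -> passes a n (key a c i) z ->
    valid a n.+1 (key a c i) /\ (a < n -> loose n (key a c i)).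
  by move=> overn passn; have [] := over_arc_valid injn vn overn passn.
have jumps y z : over_arc a n (key a c i) y z /\ slot n (key a c i) (up a n) z ->
    valid a n.+1 (key a c i) /\ (a < n -> loose n (key a c i)).
  by move=> [overn slotn]; apply: jump overn _; apply: slot_passes.
have jump2 y z y' z' : over_two_arcs a n (key a c i) y z y' z' /\
    slot n (key a c i) (up a n) z' ->
    valid a n.+1 (key a c i) /\ (a < n -> loose n (key a c i)).
  move=> [overn /(slot_passes injn) passn].
  by have [] := over_two_arcs_valid injn vn overn passn.
have [na|[na|na]] : n < a \/ n = a \/ a < n by lia.
- have [ni|[ni|ni]] : i < n \/ i = n \/ n < i by lia.
  + by apply: tight (ltnW na); apply: slot_passes => //; apply: key_inward_step; lia.
  + by subst i; have [|pass_n _] := @key_core_turn a c n _ ha; [lia|apply: tight (ltnW na)].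
  + by apply: jumps (key_core_step _ _ _ _); lia.
- have [ia|[ia|ia]] : i + 2 <= a \/ i + 1 = a \/ i = a by lia.
  + apply: tight; last by lia.
    by apply: slot_passes => //; rewrite na; apply: key_turn_pocket; lia.
  + have [c1|c1] := eqVneq c 1.
      by subst c; apply: jumps; rewrite na; apply: key_turn_ball ia.
    by apply: tight; [rewrite na; have [] := key_turn_mouth c1 ha ia|rewrite na].
  + subst i; apply: tight; last by lia.
    by apply: slot_passes => //; rewrite na; apply: key_turn_outer; lia.
(* While [i + n + 2 <= 2 * a] the tip retraces the pocket. Route 1 separates at [i + n + 1 = 2 * a]
   and route 2 at [i + n = 2 * a + 2]. *)
- have [r|r] : i + n + 2 <= 2 * a \/ 2 * a <= i + n + 1 by lia.
    by apply: jumps (@key_pocket_step a c i n (2 * a - n - 2) _ _ _ _ _); lia.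
  have [c1|c1] := eqVneq c 1.
    subst c; have [r1|r1] : i + n + 1 = 2 * a \/ 2 * a <= i + n by lia.
      by apply: jump2 (key_ball_birth _ _ _ _); lia.
    by apply: jumps (@key_ball_step a i n (2 * a - n - 1) _ _ _ _ _); lia.
  have [r1|[r1|r1]] : i + n + 1 = 2 * a \/ i + n = 2 * a \/
    2 * a + 1 <= i + n by lia.
  + have [||||over_n pass_n _] := @key_pocket_exit a c i n c1; try lia.
    exact: jump over_n pass_n.
  + exact: jumps (key_mouth_step c1 hi hn na r1).
  have [r2|[r2|r2]] : i + n = 2 * a + 1 \/ i + n = 2 * a + 2 \/
    2 * a + 3 <= i + n by lia.
  + exact: jumps (key_outer_step c1 hi hn na r2).
  + have [c0|c2'] : c = 0 \/ c = 2 by lia.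
      by subst c; apply: jump2 (key_second_birth hi hn na r2).
    subst c; have [over_n pass_n _] := key_second_entry hi hn na r2.
    exact: jump over_n pass_n.
  + have [c0|c2'] : c = 0 \/ c = 2 by lia.
      by subst c; apply: jumps (key_outward_step hi hn na r2).
    by subst c; apply: jumps (@key_second_step a i n (2 * a + 1 - n) _ _ _ _ _); lia.
Qed.

Lemma key_valid a c i n :
  2 < a -> 0 < i <= a -> (c = 1 -> i < a) -> c <= 2 -> 0 < n ->
  n + 2 <= 2 * a -> valid a n (key a c i).
Proof.
move=> ha hi ci c2; case: n => // n _; elim: n => [|n IHn] hn.
  by apply: valid1; [lia|apply: key_first].
have hn3 : n.+1 + 3 <= 2 * a by lia.
have vn : valid a n.+1 (key a c i) by apply: IHn; lia.
by have [] := key_extend ha hi ci c2 (ltn0Sn n) hn3 vn.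
Qed.

Lemma key_loose a c i n :
  2 < a -> 0 < i <= a -> (c = 1 -> i < a) -> c <= 2 -> a < n ->
  n + 3 <= 2 * a -> loose n (key a c i).
Proof.
move=> ha hi ci c2 an hn.
have n0 : 0 < n by lia.
have vn : valid a n (key a c i) by apply: key_valid => //; lia.
by have [_] := key_extend ha hi ci c2 n0 hn vn; apply.
Qed.

Lemma same_order_key a c i n k : same_order n k (key a 0 i) ->
  (forall f, f <= n -> key a c i f = key a 0 i f) -> same_order n k (key a c i).
Proof. by move=> eqk eqK f g lef leg; rewrite eqk // !eqK. Qed.

(** Face [n] is outermost on its side under both parameters: whether the spiral turns at [n] shows
    only in the next face. *)
Lemma key_core_order a n : 0 < n < a -> 2 < a ->
  same_order n (key a 0 n) (key a 0 n.+1).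
Proof.
move=> hn ha f g lef leg.
have eqK h : h < n -> key a 0 n h = key a 0 n.+1 h.
  by move=> lth; rewrite /key lth ltnS (ltnW lth).
have hi : 0 < n <= a by lia.
have hi' : 0 < n.+1 <= a by lia.
have cmp h : h < n -> (key a 0 n h < key a 0 n n) = (key a 0 n.+1 h < key a 0 n.+1 n)
    /\ (key a 0 n n < key a 0 n h) = (key a 0 n.+1 n < key a 0 n.+1 h).
  move=> lth; have keyf f' := @key_half a 0 n f' _ (erefl _) hi.
  have keyf' f' := @key_half a 0 n.+1 f' _ (erefl _) hi'.
  have [h0 En] := half_ex n; move: En keyf keyf'; rewrite [odd n.+1]/=.
  case: (odd n) => En keyf keyf';
    key_look keyf h; key_look keyf n; key_look keyf' h; key_look keyf' n; lia.
have [ltf|->] : f < n \/ f = n by lia.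
  have [ltg|->] : g < n \/ g = n by lia.
    by rewrite !eqK.
  by have [] := cmp f ltf.
have [ltg|->] : g < n \/ g = n by lia.
  by have [] := cmp g ltg.
by rewrite !ltnn.
Qed.

Lemma core_complete a n k : 2 < a -> 0 < n <= a ->
  inj_upto n k -> valid a n k ->
  exists2 i, 0 < i <= n & same_order n k (key a 0 i).
Proof.
move=> ha; case: n => // n; elim: n => [|n IHn] hn injk vk.
  exists 1 => //; have := key_first 0 (_ : 0 < 1 <= a) ha.
  have [dirk _] := vk; have := dirk 0 isT; rewrite /lt_dir /up (ltn_trans _ ha) //=.
  move=> k10 /(_ _)/= K10; have {}K10 : key a 0 1 1 < key a 0 1 0 by apply: K10; lia.
  by move=> [|[|//]] [|[|//]] _ _; rewrite ?ltnn //; lia.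
have hn' : 0 < n.+1 <= a by lia.
have [i hi eqk] :=
  IHn hn' (inj_prefix (leqnSn _) injk) (valid_prefix (leqnSn _) vk).
have injK j : 0 < j <= a -> inj_upto n.+2 (key a 0 j) by move=> hj; apply: key_inj; lia.
have [ni|ni] : i < n.+1 \/ i = n.+1 by lia.
  exists i; first lia.
  apply: (tight_same_order (injK _ _) (key_inward_step _ _ _ _) vk injk eqk); lia.
(* The spiral has not turned yet: a tight face makes it turn at [n.+1], a face passing the arc
   postpones the turn to [n.+2]. *)
subst i; have turn : 0 < n.+1 < a by lia.
have [[Knx _] Kxy] := key_core_turn 0 turn ha.
have [overn slotn] := @key_core_step a 0 n.+2 n.+1 (ltnSn _) (proj2 (andP hn)) ha.
have eqk' := same_order_trans eqk (key_core_order turn ha).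
have [] := tight_or_over_arc (injK _ _) (injK _ _) overn slotn Knx Kxy eqk eqk' vk injk.
- by lia.
- by lia.
- by move=> ?; exists n.+1 => //; lia.
- by move=> ?; exists n.+2 => //; lia.
Qed.

(* The routes that have already separated after [j] valley creases. *)
Definition allowed a j c i :=
  match c with
  | 0 => 0 < i <= a
  | 1 => a - j <= i < a
  | 2 => a - j + 3 <= i <= a
  | _ => false
  end.

Lemma valley_start_complete a k : 2 < a -> inj_upto a.+1 k -> valid a a.+1 k ->
  exists c i, allowed a 1 c i /\ same_order a.+1 k (key a c i).
Proof.
move=> ha injk vk.
have haa : 0 < a <= a by lia.
have [i hi eqk] :=
  core_complete ha haa (inj_prefix (leqnSn _) injk) (valid_prefix (leqnSn _) vk).
have injK c : inj_upto a.+1 (key a c i) by apply: key_inj; lia.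
have [ia|[ia|ia]] : i + 2 <= a \/ i + 1 = a \/ i = a by lia.
- exists 0, i; split=> //.
  by apply: (tight_same_order (injK 0) (key_turn_pocket _ _ _) vk injk eqk); lia.
- have [[Knx _] Kxy] := @key_turn_mouth a 0 i isT ha ia.
  have [overn slotn] := key_turn_ball ha ia.
  have eqk1 : same_order a k (key a 1 i).
    by apply: (same_order_key eqk) => f lef; apply: key_eq; left.
  have [] := tight_or_over_arc (injK 0) (injK 1) overn slotn Knx Kxy eqk eqk1 vk injk.
    by exists 0, i.
  by exists 1, i; split=> //=; lia.
- subst i; exists 0, a; split; first by rewrite /= leqnn andbT; lia.
  by apply: (tight_same_order (injK 0) (@key_turn_outer a 0 isT ha) vk injk eqk).
Qed.

Lemma valley_step_complete a j c i k : 2 < a -> 0 < j -> j + 3 <= a ->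
  inj_upto (a + j).+1 k -> valid a (a + j).+1 k -> loose (a + j) k ->
  allowed a j c i -> same_order (a + j) k (key a c i) ->
  exists c' i', allowed a j.+1 c' i' /\ same_order (a + j).+1 k (key a c' i').
Proof.
move=> ha j0 hj injk vk lk al eqk.
have hi : 0 < i <= a by case: c al {eqk} => [|[|[|c]]] //=; lia.
have na : a < a + j by lia.
have hn : a + j + 3 <= 2 * a by lia.
have [n En] : exists n, n = a + j by exists (a + j).
rewrite -En in injk vk lk eqk na hn *.
have injK d : inj_upto n.+1 (key a d i) by apply: key_inj; lia.
have jump y z : over_arc a n (key a c i) y z /\ slot n (key a c i) (up a n) z ->
    allowed a j.+1 c i ->
    exists c' i', allowed a j.+1 c' i' /\ same_order n.+1 k (key a c' i').
  move=> [overn slotn] al'; exists c, i; split=> //.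
  exact: over_arc_same_order overn slotn vk injk eqk lk.
case: c al eqk jump => [|[|[|c]]] //= al eqk jump; last 2 first.
- by apply: jump (@key_ball_step a i n (2 * a - n - 1) _ _ _ _ _) _; lia.
- by apply: jump (@key_second_step a i n (2 * a + 1 - n) _ _ _ _ _) _; lia.
have [r|[r|[r|r]]] : i + n + 2 <= 2 * a \/ i + n + 1 = 2 * a \/
    i + n = 2 * a \/ 2 * a + 1 <= i + n by lia.
- by apply: jump (@key_pocket_step a 0 i n (2 * a - n - 2) _ _ _ _ _) _; lia.
(* First branching: the main route is the one that stops, and route 1 passes both arcs. *)
- have [||||overn slotn] := @key_ball_birth a i n; try lia.
  have [||||_ passn Kxy] := @key_pocket_exit a 0 i n isT; try lia.
  have eqK f : f <= n -> key a 0 i f = key a 1 i f.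
    by move=> lef; rewrite [RHS]key_eq //; lia.
  have eqk1 : same_order n k (key a 1 i).
    by apply: (same_order_key eqk) => f lef; rewrite eqK.
  have [] := over_two_arcs_same_order (injK 0) (injK 1) overn slotn passn Kxy eqK
    vk injk eqk1 lk.
    by exists 0, i.
  by exists 1, i; split=> //=; lia.
- by apply: jump (@key_mouth_step a 0 i n isT _ _ _ _) _; lia.
have [r2|[r2|r2]] : i + n = 2 * a + 1 \/ i + n = 2 * a + 2 \/
    2 * a + 3 <= i + n by lia.
- by apply: jump (@key_outer_step a 0 i n isT _ _ _ _) _; lia.
(* Second branching, with the roles exchanged: route 2 stops, and the main route passes both
   arcs. *)
- have [||||overn slotn] := @key_second_birth a i n; try lia.
  have [||||_ passn Kxy] := @key_second_entry a i n; try lia.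
  have eqK f : f <= n -> key a 2 i f = key a 0 i f by move=> lef; apply: key_eq; lia.
  have [] := over_two_arcs_same_order (injK 2) (injK 0) overn slotn passn Kxy eqK
    vk injk eqk lk.
    by exists 2, i; split=> //=; lia.
  by exists 0, i.
- by apply: jump (@key_outward_step a i n _ _ _ _) _; lia.
Qed.

Lemma allowed_bounds a j c i : 0 < j -> j + 2 <= a -> allowed a j c i ->
  [/\ 0 < i <= a, c = 1 -> i < a & c <= 2].
Proof. by move=> j0 hj; case: c => [|[|[|c]]] //= hi; split; lia. Qed.

Lemma valley_complete a j k : 0 < j -> j + 2 <= a ->
  inj_upto (a + j) k -> valid a (a + j) k -> (1 < j -> loose (a + j).-1 k) ->
  exists c i, allowed a j c i /\ same_order (a + j) k (key a c i).
Proof.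
case: j => // j _; elim: j => [|j IHj] hj; rewrite ?addn1 => injk vk lk.
  by apply: valley_start_complete => //; lia.
rewrite addnS in injk vk lk *; have {}lk := lk isT.
have [||c [i [al eqk]]] := IHj _ (inj_prefix (leqnSn _) injk)
  (valid_prefix (leqnSn _) vk).
- by lia.
(* The induction needs a loose prefix only from the second valley crease on; there three consecutive
   valley creases are available for [loose_prefix]. *)
- case: j {IHj} hj injk vk lk => // j hj injk vk lk _.
  rewrite !addnS in injk vk lk *.
  by apply: (loose_prefix injk vk _ _ lk); rewrite !up_valley /= ?negbK //; lia.
by apply: valley_step_complete al eqk => //; lia.
Qed.

(** * Distinct parameters give distinct orders *)

Lemma key_turn a c i m : 2 < a -> 0 < i <= a -> 0 < m < a -> m <= i ->
  between (key a c i m) (key a c i (m - 1)) (key a c i m.+1) = (m == i).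
Proof.
move=> ha hi hm mi.
have keyf f' := @key_half a c i f' _ (erefl _) hi.
have [h0 Ei] := half_ex i; have [h1 Em] := half_ex m.
move: Ei Em keyf; case: (odd i); case: (odd m) => Ei Em keyf; rewrite /between;
  key_look keyf m; key_look keyf m.+1; key_look keyf (m - 1); lia.
Qed.

(** The parameter is visible in the order as the first face whose successor falls back between it
    and its predecessor; for [i = a] there is none before [a]. *)
Lemma key_order_inj a n i i' c c' : 2 < a -> 0 < i <= a -> 0 < i' <= a ->
  a <= n -> same_order n (key a c i) (key a c' i') -> i = i'.
Proof.
move=> ha; wlog lt_ii' : i i' c c' / i < i'.
  move=> IH hi hi' an eqk; have [?|[?|//]] : i < i' \/ i' < i \/ i = i' by lia.
    exact: IH eqk.
  by apply: esym; apply: IH (same_order_sym eqk).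
move=> hi hi' an eqk.
have := same_order_between eqk (_ : i <= n) (_ : i - 1 <= n) (_ : i.+1 <= n).
by rewrite !key_turn; lia.
Qed.

Lemma key_choice_inj a j i c c' : 0 < j -> j + 2 <= a ->
  allowed a j c i -> allowed a j c' i ->
  same_order (a + j) (key a c i) (key a c' i) -> c = c'.
Proof.
move=> j0 hj; wlog lt_cc' : c c' / c < c'.
  move=> IH al al' eqk; have [?|[?|//]] : c < c' \/ c' < c \/ c = c' by lia.
    exact: IH eqk.
  by apply: esym; apply: IH (same_order_sym eqk).
move=> al al' eqk; have [hi _ c2] := allowed_bounds j0 hj al'.
have keyf d f' := @key_half a d i f' _ (erefl _) hi.
have [c1|c02] : c = 1 \/ c' = 1 \/ c = 0 /\ c' = 2 by lia.
- have c'2 : c' = 2 by lia.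
  subst c c'; move: al al' => /= al al'.
  (* Face [2 * a - i] is the first to separate on route 1: it lies on the other side of the central
     face 0 than on the remaining routes. *)
  have := eqk (2 * a - i) 0; have := eqk 0 (2 * a - i).
  have [h0 Ei] := half_ex i; move: Ei keyf; case: (odd i) => Ei keyf;
    have keyf1 := keyf 1; have keyf2 := keyf 2;
    key_look keyf1 0; key_look keyf2 0; key_look keyf1 (2 * a - i);
    key_look keyf2 (2 * a - i); lia.
case: c02 => [c1|[c0 c'2]].
- have c0 : c = 0 by lia.
  subst c c'; move: al al' => /= al al'.
  have := eqk (2 * a - i) 0; have := eqk 0 (2 * a - i).
  have [h0 Ei] := half_ex i; move: Ei keyf; case: (odd i) => Ei keyf;
    have keyf0 := keyf 0; have keyf1 := keyf 1;
    key_look keyf0 0; key_look keyf1 0; key_look keyf0 (2 * a - i);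
    key_look keyf1 (2 * a - i); lia.
subst c c'; move: al al' => /= al al'.
(* Face [2 * a + 3 - i] is the first to separate on route 2: it lies inside face [i], while on the
   main route it lies outside. *)
have := eqk (2 * a + 3 - i) i; have := eqk i (2 * a + 3 - i).
have [h0 Ei] := half_ex i; move: Ei keyf; case: (odd i) => Ei keyf;
  have keyf0 := keyf 0; have keyf2 := keyf 2;
  key_look keyf0 i; key_look keyf2 i; key_look keyf0 (2 * a + 3 - i);
  key_look keyf2 (2 * a + 3 - i); lia.
Qed.

(** * Counting *)

Definition face_key n (s : {perm 'I_n.+1}) f := nat_of_ord (s (inord f)).

Definition validb a n (k : nat -> nat) :=
  all (fun m => lt_dir (up a m) (k m) (k m.+1)) (iota 0 n) &&
  all (fun e => all (fun e' => (odd e == odd e') ==>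
    (between (k e) (k e.+1) (k e') == between (k e) (k e.+1) (k e'.+1)))
    (iota 0 n)) (iota 0 n).

Lemma validP a n k : reflect (valid a n k) (validb a n k).
Proof.
have mem m : (m \in iota 0 n) = (m < n) by rewrite mem_iota.
apply: (iffP andP) => [[/allP dirk /allP ncrk]|[dirk ncrk]]; split.
- by move=> m lt; apply: dirk; rewrite mem.
- move=> e e' lte lte' /eqP par; apply/eqP.
  have /allP ncre := ncrk e (etrans (mem e) lte).
  by apply: (implyP (ncre e' _)); rewrite ?mem.
- by apply/allP => m; rewrite mem; apply: dirk.
- apply/allP => e; rewrite mem => lte; apply/allP => e'; rewrite mem => lte'.
  by apply/implyP => /eqP par; apply/eqP/ncrk.
Qed.

Definition looseb n (k : nat -> nat) :=
  has (fun f => between (k n) (k n.+1) (k f)) (iota 0 n.+1).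

Lemma looseP n k : reflect (loose n k) (looseb n k).
Proof.
apply: (iffP hasP) => [[f]|[f lef btw]]; last by exists f; rewrite ?mem_iota.
by rewrite mem_iota => lef btw; exists f.
Qed.

(** * Keys and permutations *)

Lemma face_key_inj n (s : {perm 'I_n.+1}) : inj_upto n (face_key s).
Proof.
move=> f g lef leg /ord_inj/perm_inj/(congr1 val).
by rewrite /= !inordK.
Qed.

Lemma same_order_perm n (s t : {perm 'I_n.+1}) :
  same_order n (face_key s) (face_key t) -> s = t.
Proof.
move=> eqst.
(* A permutation is recovered from its order: each value is the number of smaller values. *)
have rank (u : {perm 'I_n.+1}) i : nat_of_ord (u i) = #|[pred j | u j < u i]|.
  transitivity (\sum_(j < u i) 1); first by rewrite big_const_ord iter_addn_0 mul1n.
  rewrite (big_ord_widen _ (fun=> 1) (ltnW (ltn_ord (u i)))).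
  rewrite (reindex_inj (@perm_inj _ u)) -sum1_card.
  by apply: eq_bigl => j; rewrite inE.
apply/permP => i; apply: val_inj; rewrite /= (rank s) (rank t).
apply: eq_card => j.
rewrite !inE; have := eqst j i (leq_ord j) (leq_ord i).
by rewrite /face_key !inord_val.
Qed.

Lemma key_perm_ex n k : inj_upto n k ->
  exists s : {perm 'I_n.+1}, same_order n (face_key s) k.
Proof.
move=> injk; pose below (i : 'I_n.+1) := [pred j : 'I_n.+1 | k j < k i].
have lt_rank i : #|below i| < n.+1.
  rewrite -[X in _ < X]card_ord; apply/proper_card/properP.
  by split; [apply/subsetP|exists i; rewrite // !inE ltnn].
have mono (i j : 'I_n.+1) : k i < k j -> #|below i| < #|below j|.
  move=> ltij; apply/proper_card/properP; split; last first.
    by exists i; rewrite !inE ?ltnn.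
  by apply/subsetP => m; rewrite !inE => /ltn_trans; apply.
have inj_rank : injective (fun i => Ordinal (lt_rank i)).
  move=> i j [eqr]; apply/ord_inj/injk; rewrite ?leq_ord //.
  by have [/mono|/mono|//] := ltngtP (k i) (k j); rewrite eqr ltnn.
exists (perm inj_rank) => f g lef leg; rewrite /face_key !permE /=.
have [fo go] : nat_of_ord (@inord n f) = f /\ nat_of_ord (@inord n g) = g.
  by rewrite !inordK.
have := mono (inord f) (inord g); have := mono (inord g) (inord f).
rewrite fo go; have [lt|lt|/injk->//] := ltngtP (k f) (k g); last by rewrite ltnn.
  by move=> _ /(_ isT).
by move=> /(_ isT) lt' _; apply/negbTE; rewrite -leqNgt ltnW.
Qed.

(** The identity is only a default value; for keys injective up to [n] the choice succeeds. *)
Definition key_perm n (k : nat -> nat) : {perm 'I_n.+1} :=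
  odflt 1%g [pick s : {perm 'I_n.+1} | [forall f, forall g, (s f < s g) == (k f < k g)]].

Lemma key_permP n k : inj_upto n k -> same_order n (face_key (key_perm n k)) k.
Proof.
move=> injk; have same (s : {perm 'I_n.+1}) :
    reflect (same_order n (face_key s) k)
      [forall f, forall g, (s f < s g) == (k (nat_of_ord f) < k (nat_of_ord g))].
  apply: (iffP forallP) => [eqs f g lef leg|eqs f].
    by have /forallP/(_ (inord g))/eqP := eqs (inord f); rewrite !inordK.
  apply/forallP => g; apply/eqP; have := eqs f g (leq_ord f) (leq_ord g).
  by rewrite /face_key !inord_val.
rewrite /key_perm; case: pickP => [s /same//|nos].
by have [s /same] := key_perm_ex injk; rewrite nos.
Qed.

(** * Tight and loose orderings with one more face *)

Definition foldings a n := [set s : {perm 'I_n.+1} | validb a n (face_key s)].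

Definition loose_foldings a n :=
  [set s : {perm 'I_n.+2} | validb a n.+1 (face_key s) && looseb n (face_key s)].

Definition tight_foldings a n :=
  [set s : {perm 'I_n.+2} | validb a n.+1 (face_key s) && ~~ looseb n (face_key s)].

Lemma tight_order_extend a n k K :
  inj_upto n.+1 k -> inj_upto n.+1 K -> valid a n.+1 k -> valid a n.+1 K ->
  gap n k n n.+1 -> gap n K n n.+1 -> same_order n k K -> same_order n.+1 k K.
Proof.
move=> injk injK [dirk _] [dirK _] gapk gapK eqk.
apply: same_order_extend => // f lef.
have neqk : k f <> k n.+1 by move/(injk f n.+1); lia.
have neqK : K f <> K n.+1 by move/(injK f n.+1); lia.
have := eqk f n lef (leqnn n); have := eqk n f (leqnn n) lef.
have := gapk f lef; have := gapK f lef.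
have := dirk n (ltnSn n); have := dirK n (ltnSn n).
by rewrite /lt_dir /between; case: (up _ _); lia.
Qed.

(** Old keys become odd, which frees an even key on either side of face [n]. *)
Definition tighten a n (k : nat -> nat) f :=
  if f == n.+1 then (if up a n then (k n).*2.+2 else (k n).*2) else (k f).*2.+1.

Lemma tighten_order a n k : same_order n (tighten a n k) k.
Proof. by move=> f g lef leg; rewrite /tighten !ltn_eqF //; lia. Qed.

Lemma tighten_inj a n k : inj_upto n k -> inj_upto n.+1 (tighten a n k).
Proof.
move=> injk f g lef leg; rewrite /tighten.
have := injk f g.
by have [->|nf] := eqVneq f n.+1; have [->|ng] := eqVneq g n.+1;
  case: (up _ _) => //; lia.
Qed.

Lemma tighten_valid a n k : inj_upto n k -> valid a n k ->
  valid a n.+1 (tighten a n k) /\ gap n (tighten a n k) n n.+1.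
Proof.
move=> injk vk.
have gapk : gap n (tighten a n k) n n.+1.
  move=> f lef; rewrite /tighten eqxx !ltn_eqF // /between.
  by case: (up _ _); lia.
split=> //; apply: tight_valid gapk; first exact: tighten_inj.
  exact: same_order_valid (@tighten_order a n k) vk.
by rewrite /lt_dir /tighten eqxx ltn_eqF //; case: (up _ _); lia.
Qed.

(** Restriction to the shorter strip is a bijection: injective because the tight place is unique,
    surjective by [tighten]. *)
Lemma card_tight a n : #|tight_foldings a n| = #|foldings a n|.
Proof.
pose restrict (s : {perm 'I_n.+2}) := key_perm n (face_key s).
have injs (s : {perm 'I_n.+2}) : inj_upto n (face_key s).
  exact: inj_prefix (leqnSn n) (@face_key_inj _ s).
have gapP k : ~~ looseb n k -> gap n k n n.+1.
  by move=> /looseP nl; have [] := loose_or_gap n k.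
rewrite -(@card_in_imset _ _ restrict) => [|s t]; last first.
  rewrite !inE => /andP[/validP vs /gapP gs] /andP[/validP vt /gapP gt] eqst.
  apply: same_order_perm.
  apply: (tight_order_extend (@face_key_inj _ s) (@face_key_inj _ t) vs vt gs gt).
  apply: same_order_trans (same_order_sym (key_permP (injs s))) _.
  by rewrite -/(restrict s) eqst; apply: key_permP.
apply: eq_card => t; rewrite !inE; apply/imsetP/validP => [[s]|vt].
  rewrite inE => /andP[/validP vs _] ->.
  apply: same_order_valid (key_permP (injs s)) _.
  exact: valid_prefix (leqnSn n) vs.
have injt := @face_key_inj _ t.
have [vk gk] := tighten_valid injt vt.
have injk := @tighten_inj a _ _ injt.
have eqk := key_permP injk.
exists (key_perm n.+1 (tighten a n (face_key t))).
  rewrite inE; apply/andP; split; first by apply/validP/(same_order_valid eqk).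
  apply/looseP => -[f lef].
  by rewrite (same_order_between eqk) ?(negbTE (gk f lef)) //; lia.
apply: same_order_perm.
apply: same_order_trans (same_order_sym (key_permP (injs _))).
apply: same_order_trans (same_order_sym (same_order_prefix (leqnSn n) eqk)).
exact: same_order_sym (@tighten_order a n _).
Qed.

Lemma card_foldingsS a n :
  #|foldings a n.+1| = #|foldings a n| + #|loose_foldings a n|.
Proof.
rewrite -(card_tight a n) -(cardsID [set s | looseb n (face_key s)]) addnC.
by congr (_ + _); apply: eq_card => s; rewrite !inE // andbC.
Qed.

(** * Counting the parameters *)

Definition params a j :=
  [seq (0, i) | i <- iota 1 a] ++ [seq (1, i) | i <- iota (a - j) j] ++
  [seq (2, i) | i <- iota (a - j + 3) (j - 2)].

Lemma size_params a j : size (params a j) = a + j + (j - 2).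
Proof. by rewrite !size_cat !size_map !size_iota addnA. Qed.

Lemma mem_params a j (c i : nat) : 0 < j -> j + 2 <= a ->
  ((c, i) \in params a j) = allowed a j c i.
Proof.
move=> j0 hj; rewrite !mem_cat.
have mem (d : nat) s : ((c, i) \in [seq (d, i') | i' <- s]) = (c == d) && (i \in s).
  apply/mapP/andP => [[i' ins [-> ->]]|[/eqP-> ins]]; first by rewrite eqxx.
  by exists i.
rewrite !mem !mem_iota; case: c {mem} => [|[|[|c]]] //=; lia.
Qed.

Lemma uniq_params a j : uniq (params a j).
Proof.
have inj d : injective (fun i : nat => (d : nat, i)) by move=> i i' [].
have mem (d c i : nat) s : ((c, i) \in [seq (d, i') | i' <- s]) -> c = d.
  by move=> /mapP[i' _ []].
rewrite /params !cat_uniq !(map_inj_uniq (inj _)) !iota_uniq /= !andbT.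
apply/andP; split; apply/hasPn => -[c i]; rewrite ?mem_cat.
  by move=> /orP[] /mem->; apply/negP => /mem.
by move=> /mem->; apply/negP => /mem.
Qed.

Lemma card_param_orders a j n (X : {set {perm 'I_n.+1}}) :
  n = a + j -> 2 < a -> 0 < j -> j + 2 <= a ->
  (forall s, s \in X <-> exists c i, allowed a j c i /\
     same_order n (face_key s) (key a c i)) ->
  #|X| = a + j + (j - 2).
Proof.
move=> En ha j0 hj XP; rewrite -size_params.
have an : a <= n by lia.
pose fold (p : nat * nat) := key_perm n (key a p.1 p.2).
have foldP c i : allowed a j c i ->
    same_order n (face_key (fold (c, i))) (key a c i).
  move=> al; have [hi _ _] := allowed_bounds j0 hj al.
  by apply: key_permP; apply: key_inj => //; lia.
have inj_fold : {in params a j &, injective fold}.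
  move=> [c i] [c' i']; rewrite !mem_params // => al al' eqf.
  have [hi _ _] := allowed_bounds j0 hj al; have [hi' _ _] := allowed_bounds j0 hj al'.
  have eqk := same_order_trans (same_order_sym (foldP c i al)).
  have {}eqk : same_order n (key a c i) (key a c' i').
    by apply: eqk; rewrite eqf; apply: foldP.
  have eqi := key_order_inj ha hi hi' an eqk; subst i'.
  by rewrite En in eqk; rewrite (key_choice_inj j0 hj al al' eqk).
rewrite -(size_map fold); have /card_uniqP <- : uniq (map fold (params a j)).
  by rewrite map_inj_in_uniq ?uniq_params.
apply: eq_card => s; apply/idP/mapP => [/XP[c [i [al eqk]]]|[[c i]]].
  exists (c, i); first by rewrite mem_params.
  exact/same_order_perm/(same_order_trans eqk)/same_order_sym/foldP.
rewrite mem_params // => al ->; apply/XP.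
by exists c, i; split=> //; apply: foldP.
Qed.

Lemma card_first_valley a : 2 < a -> #|foldings a (a + 1)| = a + 1.
Proof.
(* For [j = 1] the truncated [j - 2] is 0: route 2 contributes nothing. *)
move=> ha; rewrite (@card_param_orders a 1) //; first lia.
move=> s; rewrite inE; split=> [/validP vs|[c [i [al eqk]]]].
  by apply: valley_complete => //; exact: face_key_inj.
have [||hi ci c2] := allowed_bounds _ _ al; try by lia.
by apply/validP/(same_order_valid eqk)/key_valid => //; lia.
Qed.

Lemma card_loose a j : 0 < j -> j + 3 <= a ->
  #|loose_foldings a (a + j)| = a + j.+1 + (j.+1 - 2).
Proof.
move=> j0 hj; have ha : 2 < a by lia.
apply: card_param_orders => //; [by rewrite addnS|by lia|].
move=> s; rewrite inE; split=> [/andP[/validP vs /looseP ls]|[c [i [al eqk]]]].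
  move: (face_key s) (@face_key_inj _ s) vs ls => k injk vk lk.
  rewrite -addnS in injk vk *.
  by apply: valley_complete => //; [lia|rewrite addnS].
have [||hi ci c2] := allowed_bounds _ _ al; try by lia.
apply/andP; split; first by apply/validP/(same_order_valid eqk)/key_valid => //; lia.
by apply/looseP/(same_order_loose eqk)/key_loose => //; lia.
Qed.

(** The first valley crease gives [a + 1], and the [t]-th one adds the [a + 2 * t - 2] loose
    orderings. *)
Lemma card_foldings a j : j.+1 + 2 <= a ->
  #|foldings a (a + j.+1)| = a * j.+1 + j.+1 ^ 2 - j.+1 + 1.
Proof.
elim: j => [|j IHj] hj; first by rewrite card_first_valley; lia.
rewrite addnS card_foldingsS card_loose //; last by lia.
by rewrite IHj; lia.
Qed.

(** * Comparison with the layer orderings of the statement *)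

Lemma rotations_between x y x' y' :
  x <> y -> x <> y' -> x' <> y -> x' <> y' ->
  between x x' y = between x x' y' <->
  [forall k : 'I_4, ~~ sorted ltn (rot k [:: x; y; x'; y'])] /\
  [forall k : 'I_4, ~~ sorted ltn (rot k [:: y; x; y'; x'])].
Proof.
move=> nxy nxy' nx'y nx'y'.
have rots u v u' v' : [forall k : 'I_4, ~~ sorted ltn (rot k [:: u; v; u'; v'])] =
    [&& ~~ [&& u < v, v < u' & u' < v'], ~~ [&& v < u', u' < v' & v' < u],
        ~~ [&& u' < v', v' < u & u < v] & ~~ [&& v' < u, u < v & v < u']].
  apply/forallP/and4P => [nrot|[n0 n1 n2 n3] [[|[|[|[|//]]]] lt4]];
    rewrite /= ?andbT //.
  have := nrot (@Ordinal 4 0 isT); have := nrot (@Ordinal 4 1 isT).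
  have := nrot (@Ordinal 4 2 isT); have := nrot (@Ordinal 4 3 isT).
  by rewrite /= !andbT.
(* Two creases cross when their ends alternate cyclically; the two conjuncts exclude the two cyclic
   orders in which this can happen. *)
by rewrite !rots /between; lia.
Qed.

Lemma mountains_valleysE a b (i : 'I_(a + b)) :
  tnth (mountains_valleys a b) i = if i < a then Mountain else Valley.
Proof.
rewrite (tnth_nth Mountain) /= nth_cat size_nseq !nth_nseq.
by case: ifP => // ia; rewrite ifT //; have := ltn_ord i; lia.
Qed.

Lemma valid_layer_orderingE a b (s : {perm 'I_(a + b).+1}) :
  valid_layer_ordering (mountains_valleys a b) s = validb a (a + b) (face_key s).
Proof.
have lkey (i : 'I_(a + b)) : nat_of_ord (s (lface i)) = face_key s i.
  by congr (nat_of_ord (s _)); apply: val_inj; rewrite /= inordK // ltnW // ltnS.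
have rkey (i : 'I_(a + b)) : nat_of_ord (s (rface i)) = face_key s i.+1.
  congr (nat_of_ord (s _)); apply: val_inj.
  by rewrite /= inordK // ltnS.
have neq f g : f <= a + b -> g <= a + b -> f <> g -> face_key s f <> face_key s g.
  by move=> lef leg ne /face_key_inj; auto.
apply/andP/validP => [[/forallP dirs /forallP ncrs]|[dirs ncrs]].
  split=> [m ltm|e e' lte lte' par].
    have := dirs (Ordinal ltm); rewrite mountains_valleysE lkey rkey /= /lt_dir /up.
    by case: (m < a); case: (odd m).
  have [->|ne] := eqVneq e e'; first by rewrite /between; lia.
  have ncr i j (lti : i < a + b) (ltj : j < a + b) : odd i = odd j ->
      [forall k : 'I_4, ~~ sorted ltn (rot k [:: face_key s i; face_key s j;
         face_key s i.+1; face_key s j.+1])].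
    move=> parij; have /forallP/(_ (Ordinal ltj)) := ncrs (Ordinal lti).
    by rewrite !lkey !rkey /= parij eqxx.
  have := odd_neqS par; have := odd_neqS (esym par) => ? ?.
  by apply/rotations_between; [apply: neq; lia ..|split; apply: ncr].
split; apply/forallP => i.
  have := dirs i (ltn_ord i); rewrite mountains_valleysE lkey rkey /lt_dir /up.
  by case: (i < a); case: (odd i).
apply/forallP => j; apply/implyP => /eqP par; rewrite !lkey !rkey.
have [ij|ne] := eqVneq (i : nat) j.
  apply/forallP => -[[|[|[|[|//]]]] lt4]; rewrite ij /=; lia.
have := odd_neqS par; have := odd_neqS (esym par) => ? ?.
have := ltn_ord i; have := ltn_ord j => ? ?.
have btw := ncrs i j (ltn_ord i) (ltn_ord j) par.
by have [] := (proj1 (rotations_between _ _ _ _)) btw; do ?[apply: neq; lia].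
Qed.

Theorem theorem3p1 (a b : nat) (hab : b + 1 < a) (hb : 4 < b) :
  num_layer_orderings (mountains_valleys a b) = a * b + b ^ 2 - b + 1.
Proof.
case: b hab hb => // b hab _; rewrite -card_foldings; last by lia.
by apply: eq_card => s; rewrite !inE valid_layer_orderingE.
Qed.
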